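(* Let $K$ be a field, $S=K[x_1,\ldots,x_n]$, and let $\Delta$ be a pure simplicial complex on $[n]$ with $\operatorname{depth} K[\Delta]=t$. Let $I\subset S$ be an unmixed monomial ideal with $\sqrt{I}=I_\Delta$, and write $I=\bigcap_{F\in\mathcal{F}(\Delta)} I_F$, where $I_F$ is the $P_F$-primary component of $I$. Then the following conditions are equivalent: (a) $\operatorname{depth}(S/I)=\operatorname{depth}(S/\sqrt{I})$; (b) $\operatorname{depth} K[\Delta_{\mathbf a}]\geq t$ for all $\mathbf a\in\mathbb{N}^n$ with $\Delta_{\mathbf a}\neq\emptyset$; (c) $L_\Gamma(I)=\emptyset$ for every (nonempty) simplicial complex $\Gamma$ with $\mathcal{F}(\Gamma)\subseteq\mathcal{F}(\Delta)$ and $\operatorname{depth} K[\Gamma]<t$.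
   Context: $\mathbb{N}=\{0,1,2,\ldots\}$, $[n]=\{1,\ldots,n\}$. For a simplicial complex $\Delta$ on $[n]$ (not every $i\in[n]$ need be a vertex), $\mathcal{F}(\Delta)$ is its set of facets; $\Delta$ is pure if all facets have the same cardinality. For $F\subseteq[n]$, $P_F=(x_i \mid i\notin F)\subset S$. The Stanley-Reisner ideal is $I_\Delta=\bigcap_{F\in\mathcal{F}(\Delta)}P_F$ and $K[\Delta]=S/I_\Delta$. Simplicial complexes such as $\Delta$ and $\Gamma$ are nonempty (they have at least one facet). An ideal $I\subset S$ is unmixed if the associated primes of $S/I$ are exactly the minimal primes of $I$. Thus if $I$ is an unmixed monomial ideal with $\sqrt I=I_\Delta$, its associated primes are the $P_F$, $F\in\mathcal{F}(\Delta)$. For $\mathbf a=(a_1,\ldots,a_n)\in\mathbb{N}^n$, $\mathbf x^{\mathbf a}=x_1^{a_1}\cdots x_n^{a_n}$, and $\Delta_{\mathbf a}$ is the simplicial complex on $[n]$ with facet set $\mathcal{F}(\Delta_{\mathbf a})=\{F\in\mathcal{F}(\Delta)\mid \mathbf x^{\mathbf a}\notin I_F\}$ ($\Delta_{\mathbf a}=\emptyset$ means that this set of facets is empty). For a simplicial complex $\Gamma$ with $\mathcal{F}(\Gamma)\subseteq\mathcal{F}(\Delta)$, $$L_\Gamma(I)=\Big\{\mathbf a\in\mathbb{N}^n \;\Big|\; \mathbf x^{\mathbf a}\in \bigcap_{F\in\mathcal{F}(\Delta)\setminus\mathcal{F}(\Gamma)} I_F\ \setminus \bigcup_{G\in\mathcal{F}(\Gamma)}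 I_G\Big\},$$ where an empty intersection is $S$. The depth is with respect to the graded maximal ideal $(x_1,\ldots,x_n)$. *)

(* Defs.v *)
(* Ideals are boolean predicates, by way of the classical reflection          *)
(* `[< _ >] of mathcomp.classical.boolp.                                      *)
From mathcomp Require Import all_boot all_order all_algebra.
From mathcomp Require Import mpoly.
From mathcomp Require Import boolp.
From mathcomp Require classical_sets.

Set Implicit Arguments.
Unset Strict Implicit.
Unset Printing Implicit Defensive.

Import GRing.Theory.
Local Open Scope ring_scope.

Section Ideals.
Variable R : comNzRingType.
Implicit Types (A I J P Q : {pred R}) (fs : seq R).

Definition ideal_gen A : {pred R} :=
  [pred f | `[< exists2 s : seq (R * R),
                  all (fun p => p.2 \in A) s & f = \sum_(p <- s) p.1 * p.2 >]].

Definition radical I : {pred R} := [pred f | `[< exists k, f ^+ k \in I >]].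

(* [idealr_closed] includes properness (1 is not in the ideal). *)
Definition prime_ideal P := idealr_closed P /\ prime_idealr_closed P.

Definition primary_to P Q :=
  [/\ idealr_closed Q,
      forall f g, f * g \in Q -> f \in Q \/ g \in radical Q
    & radical Q =i P].

(* P is associated to the module R/I: a prime ideal that is the annihilator   *)
(* of the class of some g.                                                    *)
Definition associated_prime I P :=
  prime_ideal P /\ exists g, forall f, (f \in P) = (f * g \in I).

Definition minimal_prime I P :=
  [/\ prime_ideal P, {subset I <= P}
    & forall Q, prime_ideal Q -> {subset I <= Q} -> {subset Q <= P} -> Q =i P].

Definition unmixed I :=
  forall P, associated_prime I P <-> minimal_prime I P.

(* fs is a regular sequence on the module R/I. *)
Definition regular_seq I fs :=
  let J k := ideal_gen [predU I & take k fs] in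
  (forall k, (k < size fs)%N -> forall g, fs`_k * g \in J k -> g \in J k)
  /\ 1 \notin J (size fs).

Definition is_depth (m : {pred R}) I (d : nat) :=
  (exists fs, [/\ {subset fs <= m}, regular_seq I fs & size fs = d])
  /\ (forall fs, {subset fs <= m} -> regular_seq I fs -> (size fs <= d)%N).

(* The depth of R/I with respect to m: the largest length of a regular        *)
(* sequence on R/I contained in m.  This maximum exists when R is noetherian  *)
(* and I + m is proper; the default value 0 covers the remaining cases.       *)
Definition depth_at (m : {pred R}) I : nat :=
  classical_sets.xget 0%N (is_depth m I).

End Ideals.

Section Complexes.
Variable n : nat.
Implicit Types (D G : {set {set 'I_n}}) (F : {set 'I_n}).

(* The complex {set0} is allowed; the void one is not.  A point of 'I_n need  *)
(* not be a vertex.                                                           *)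
Definition simplicial_complex D :=
  D != set0 /\ forall A B : {set 'I_n}, A \in D -> B \subset A -> B \in D.

Definition facets D : {set {set 'I_n}} :=
  [set F | maxset (fun A : {set 'I_n} => A \in D) F].

Definition pure D :=
  forall F F', F \in facets D -> F' \in facets D -> #|F| = #|F'|.

Variable K : fieldType.
Local Notation S := {mpoly K[n]}.

Definition monomial_ideal (I : {pred S}) :=
  exists A : {pred 'X_{1..n}},
    I =i ideal_gen [pred f : S | `[< exists2 a, a \in A & f = 'X_[a] >]].

Definition face_prime F : {pred S} :=
  ideal_gen [pred f : S | [exists i, (i \notin F) && (f == 'X_i)]].

Definition SR_ideal D : {pred S} :=
  [pred f | [forall F in facets D, f \in face_prime F]].

(* [face_prime set0] is the graded maximal ideal, generated by all variables. *)
Definition depth (I : {pred S}) : nat := depth_at (face_prime set0) I.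

(* In what follows IF F, for F a facet of D, is the F-th primary component.   *)
Variable IF : {set 'I_n} -> {pred S}.

Definition degree_complex D (a : 'X_{1..n}) : {set {set 'I_n}} :=
  [set A : {set 'I_n} |
     [exists F in facets D, ('X_[a] \notin IF F) && (A \subset F)]].

Lemma facets_degree_complex D a :
  facets (degree_complex D a) = [set F in facets D | 'X_[a] \notin IF F].
Proof.
apply/setP => F; rewrite !inE; apply/maxsetP/andP => [[]|[FD aF]].
- rewrite inE => /exists_inP[F' F'D /andP[aF' FF']] Fmax.
  have E : F' = F.
    by apply: Fmax => //; rewrite inE; apply/exists_inP; exists F'; rewrite ?aF'/=.
  by move: F'D aF'; rewrite E inE.
- split=> [|B]; rewrite inE.
    by apply/exists_inP; exists F; rewrite ?inE // aF /=.
  case/exists_inP => F'; rewrite inE => F'D /andP[_ BF'] FB.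
  apply/eqP; rewrite eqEsubset FB andbT.
  have [_ /(_ F')] := maxsetP FD.
  by case/maxsetP: F'D => F'D _ /(_ F'D (subset_trans FB BF')) <-.
Qed.

Definition L_set D G : {pred 'X_{1..n}} :=
  [pred a : 'X_{1..n} |
     [forall F in facets D :\: facets G, 'X_[a] \in IF F]
     && [forall F in facets G, 'X_[a] \notin IF F]].

End Complexes.

Arguments face_prime {n} K F.
Arguments SR_ideal {n} K D.

(* Main.v *)
(* Let N be large.  The depth of S/J is the least i for which the Koszul       *)
(* cohomology H^i(x_1^N, ..., x_n^N; S/J) is nonzero.  When I is a monomial   *)
(* ideal, this cohomology splits into graded pieces, and N being larger than  *)
(* the exponents of I, the complex of each graded piece has as basis the sets *)
(* A containing a given G with A \ G in Delta_a; every pair (G, a) occurs.    *)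
(* Hence k <= depth S/I is the vanishing, for all G and a, of the reduced     *)
(* cohomology of Delta_a restricted to the complement of G, in a range        *)
(* depending only on k and #|G|.  The same criterion holds for the            *)
(* Stanley-Reisner ideal of Delta_a, where (Delta_a)_b = Delta_(a + N b') with *)
(* b' the indicator of the support of b.  Therefore                           *)
(*     depth S/I = min_a depth K[Delta_a],                                    *)
(* and a = 0 gives Delta_0 = Delta.                                           *)
Require Import Defs.
From mathcomp Require Import all_boot all_order all_algebra.
From mathcomp Require Import mpoly.
From mathcomp Require Import boolp.
From mathcomp Require Import ring zify.
From mathcomp Require classical_sets.

Set Implicit Arguments.
Unset Strict Implicit.
Unset Printing Implicit Defensive.

Import Order.TTheory GRing.Theory.
Local Open Scope ring_scope.

(** * Regular elements modulo an ideal of a noetherian ring *)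

(** Everything rests on [leq_depth_degree_complex]: depth S/I is at least k iff every nonvoid
    Delta_a has depth K[Delta_a] at least k. As Delta_0 = Delta ([degree_complex0]), depth S/I is at
    most t, and equality is condition (b). For Gamma as in (c), L_Gamma(I) consists of the a with
    Delta_a = Gamma ([L_set_degree_complex], [mem_L_set_degree_complex]), so (b) and (c) agree.

    By [leq_depth_at], depth is read off from Koszul cohomology on any [y] generating the maximal
    ideal up to radical, hence on high powers of the variables. [kvanish_graded_piece] splits this
    cohomology by multidegree, and [leq_depth_colon_complex] makes it a family of acyclicity
    conditions on colon complexes. [leq_depth_SR] finds the same family in the Stanley-Reisner
    ideals of these complexes, which [colon_complex_degree_complex] identifies with the Delta_a. *)

Section IdealTheory.
Variable R : comNzRingType.
Implicit Types (A I J m : {pred R}) (s : seq R).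

(** Unlike [idealr_closed], this admits the unit ideal: colon ideals and sums J + (f) may be
    improper. *)
Definition is_ideal J :=
  0 \in J /\ forall a x y, x \in J -> y \in J -> a * x + y \in J.

Lemma ideal0 J : is_ideal J -> 0 \in J.
Proof. by case. Qed.

Lemma idealMl J a x : is_ideal J -> x \in J -> a * x \in J.
Proof. by case=> J0 JD xJ; rewrite -[_ * _]addr0 JD. Qed.

Lemma idealD J x y : is_ideal J -> x \in J -> y \in J -> x + y \in J.
Proof. by case=> _ JD xJ yJ; rewrite -[x]mul1r JD. Qed.

Lemma idealN J x : is_ideal J -> x \in J -> - x \in J.
Proof. by move=> JI xJ; rewrite -mulN1r idealMl. Qed.

Lemma idealB J x y : is_ideal J -> x \in J -> y \in J -> x - y \in J.
Proof. by move=> JI xJ yJ; rewrite idealD // idealN. Qed.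

Lemma ideal_sum J (T : eqType) (r : seq T) (P : pred T) (F : T -> R) :
  is_ideal J -> (forall i, i \in r -> P i -> F i \in J) ->
  \sum_(i <- r | P i) F i \in J.
Proof.
move=> JI FJ; rewrite big_seq_cond.
apply: (big_ind (fun x => x \in J)) => [|x y|i /andP[]]; first exact: ideal0.
  exact: idealD.
exact: FJ.
Qed.

Lemma ideal_gen_ideal A : is_ideal (ideal_gen A).
Proof.
split; first by apply/asboolP; exists [::]; rewrite ?big_nil.
move=> a x y /asboolP[s sA ->] /asboolP[t tA ->]; apply/asboolP.
exists ([seq (a * p.1, p.2) | p <- s] ++ t).
  by rewrite all_cat tA all_map andbT.
rewrite big_cat big_map mulr_sumr /=; congr (_ + _).
by apply: eq_bigr => p _; rewrite mulrA.
Qed.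

Lemma mem_ideal_gen A x : x \in A -> x \in ideal_gen A.
Proof.
move=> xA; apply/asboolP; exists [:: (1, x)]; rewrite /= ?xA //.
by rewrite big_seq1 mul1r.
Qed.

Lemma ideal_gen_min A J :
  is_ideal J -> {subset A <= J} -> {subset ideal_gen A <= J}.
Proof.
move=> JI AJ x /asboolP[s /allP sA ->]; apply: ideal_sum => // p ps _.
by rewrite idealMl // AJ // sA.
Qed.

Lemma idealr_closed_ideal J : idealr_closed J -> is_ideal J.
Proof. by case=> J0 _ JD; split. Qed.

Definition noetherian :=
  forall A, exists2 s : seq R, {subset s <= A} & {subset A <= ideal_gen (mem s)}.

(** The colon ideal (J : g) is maximal among annihilators of nonzero classes of R/J, hence an
    associated prime; it is handled through g alone. *)
Definition max_annihilator J g :=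
  g \notin J /\ forall h, h \notin J -> (forall f, f * g \in J -> f * h \in J) ->
    forall f, f * h \in J -> f * g \in J.

(** Otherwise annihilators above that of g0 would grow strictly for ever, but the union of such a
    chain is finitely generated and so is reached at some stage. *)
Lemma max_annihilator_above J g0 : noetherian -> is_ideal J -> g0 \notin J ->
  exists2 g, max_annihilator J g & forall f, f * g0 \in J -> f * g \in J.
Proof.
move=> noeth JI g0J; apply: contrapT => none.
pose P g := g \notin J /\ forall f, f * g0 \in J -> f * g \in J.
have step g : exists h, P g -> [/\ P h, forall f, f * g \in J -> f * h \in J
    & exists2 f, f * h \in J & f * g \notin J].
  apply: contrapT => /forallNP noh; apply: none; exists g.
    have Pg : P g by apply: contrapT => nPg; apply: (noh g) => /nPg.
    split=> [|h hJ gh f fh]; first by case: Pg.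
    apply/contraT => fg; case: (noh h) => _; split=> //; last by exists f.
    by split=> // f' /(proj2 Pg)/gh.
  by apply: contrapT => nPg; apply: (noh g) => -[_ /nPg].
have [nxt nxtP] := choice step.
pose u k := iter k nxt g0.
have Pu k : P (u k) by elim: k => [|k IH] //=; case: (nxtP _ IH).
have u_mono k l f : (k <= l)%N -> f * u k \in J -> f * u l \in J.
  move=> /subnK <-; elim: (l - k)%N => // d IH /IH.
  by case: (nxtP _ (Pu (d + k)%N)) => _ /(_ f).
have [s sW Ws] := noeth [pred f | `[< exists k, f * u k \in J >]].
have [k sk] : exists k, forall f, f \in s -> f * u k \in J.
  elim: s sW {Ws} => [|f s IH] sW; first by exists 0%N.
  have [|k sk] := IH; first by move=> x xs; rewrite sW // inE xs orbT.
  have /asboolP[l fl] := sW f (mem_head _ _).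
  exists (maxn k l) => x; rewrite inE => /predU1P[->|xs].
    exact: u_mono (leq_maxr _ _) fl.
  exact: u_mono (leq_maxl _ _) (sk _ xs).
have [_ _ [f fS fN]] := nxtP _ (Pu k).
case/negP: fN.
have annI : is_ideal [pred x | x * u k \in J].
  split=> [|a x y]; rewrite !inE ?mul0r ?ideal0 // => xk yk.
  by rewrite mulrDl -mulrA idealD // idealMl.
apply: (ideal_gen_min annI (A := mem s) sk); apply: Ws.
by apply/asboolP; exists k.+1.
Qed.

(** If b g is not in J, then (J : b g) contains (J : g), and maximality makes them equal. *)
Lemma max_annihilator_prime J g a b : is_ideal J -> max_annihilator J g ->
  a * b * g \in J -> a * g \in J \/ b * g \in J.
Proof.
move=> JI [gJ gmax] abg; case: (boolP (b * g \in J)) => bg; [by right|left].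
apply: (gmax (b * g)) => //; last by rewrite mulrA.
by move=> f fg; rewrite mulrCA idealMl.
Qed.

Lemma max_annihilator_separate J g s : is_ideal J -> max_annihilator J g ->
  (forall q, q \in s -> exists2 c, c * q \in J & c * g \notin J) ->
  exists2 c, (forall q, q \in s -> c * q \in J) & c * g \notin J.
Proof.
move=> JI gmax; elim: s => [|p s IH] sep.
  by exists 1 => //; rewrite mul1r; case: gmax.
have [|c cs cg] := IH; first by move=> q qs; apply: sep; rewrite inE qs orbT.
have [d dp dg] := sep p (mem_head _ _).
exists (c * d) => [q|].
  rewrite inE => /predU1P[->|qs]; first by rewrite -mulrA idealMl.
  by rewrite mulrAC mulrC idealMl // cs.
by apply/negP => /(max_annihilator_prime JI gmax)[]; apply/negP.
Qed.

(** Prime avoidance: if f falls into (J : p), it is corrected by u c, where c kills the other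
    elements modulo J but not p, and u in m lies outside (J : p). *)
Lemma avoid_max_annihilators J m s : is_ideal J -> is_ideal m ->
  (forall g, (forall f, f \in m -> f * g \in J) -> g \in J) ->
  (forall g, g \in s -> max_annihilator J g) ->
  exists2 f, f \in m & forall g, g \in s -> f * g \notin J.
Proof.
move=> JI mI socle0; elim: s => [|p s IH] smax.
  by exists 0; first exact: ideal0.
have pmax := smax p (mem_head _ _).
have {}smax q : q \in s -> max_annihilator J q.
  by move=> qs; apply: smax; rewrite inE qs orbT.
have [f fm fs] := IH smax.
case: (boolP (f * p \in J)) => fp; last first.
  by exists f => // g; rewrite inE => /predU1P[->|/fs].
have [c cs cp] : exists2 c, (forall q, q \in s -> c * q \in J) & c * p \notin J.
  (* Were (J : q) inside (J : p), maximality would make them equal and f would kill q. *)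
  apply: max_annihilator_separate => // q qs; apply: contrapT => nsep.
  case/negP: (fs q qs).
  apply: (proj2 (smax q qs) p) => //; first by case: pmax.
  by move=> c cq; apply/contraT => cp; case: nsep; exists c.
have [u um up] : exists2 u, u \in m & u * p \notin J.
  apply: contrapT => nu; case/negP: (proj1 pmax); apply: socle0 => u um.
  by apply/contraT => up; case: nu; exists u.
exists (f + u * c); first by rewrite idealD // mulrC idealMl.
move=> g; rewrite inE => /predU1P[->|gs]; apply/negP; rewrite mulrDl => H.
  have : u * c * p \in J by rewrite -(addKr (f * p) (_ * p)) addrC idealB.
  by move=> /(max_annihilator_prime JI pmax)[]; apply/negP.
case/negP: (fs g gs); rewrite -(addrK (u * c * g) (f * g)) idealB //.
by rewrite -mulrA idealMl // cs.
Qed.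

(** In place of finiteness of the associated primes, s is a finite set generating the ideal of all g
    with maximal annihilator. If f avoids the annihilators of s but kills a nonzero class, it lies
    in some maximal (J : g); then some c kills s but not g, although g is generated by s. *)
Lemma exists_regular J m : noetherian -> is_ideal J -> is_ideal m ->
  (forall g, (forall f, f \in m -> f * g \in J) -> g \in J) ->
  exists2 f, f \in m & forall g, f * g \in J -> g \in J.
Proof.
move=> noeth JI mI socle0.
have [s smax s_gen] := noeth [pred g | `[< max_annihilator J g >]].
have {}smax g : g \in s -> max_annihilator J g by move/smax/asboolP.
have [f fm fs] := avoid_max_annihilators JI mI socle0 smax.
exists f => // h fh; apply/contraT => hJ.
have [g gmax hg] := max_annihilator_above noeth JI hJ.
have [c cs] : exists2 c, (forall q, q \in s -> c * q \in J) & c * g \notin J.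
  apply: max_annihilator_separate => // q qs; apply: contrapT => nsep.
  case/negP: (fs q qs); apply: (proj2 (smax q qs) g); last exact: hg.
    by case: gmax.
  by move=> c cq; apply/contraT => cp; case: nsep; exists c.
case/negP.
have cI : is_ideal [pred x | c * x \in J].
  split=> [|a x y]; rewrite !inE ?mulr0 ?ideal0 // => xk yk.
  by rewrite mulrDr mulrCA idealD // idealMl.
by apply: (ideal_gen_min cI (A := mem s) cs); apply/s_gen/asboolP.
Qed.

End IdealTheory.

(** * Polynomial rings are noetherian *)

Section Dickson.
Variable n : nat.
Implicit Types (a b : 'X_{1..n}) (u : nat -> 'X_{1..n}).

(** Each index is chosen to minimize [v] over the tail after the previous one. *)
Lemma nondecreasing_subsequence (v : nat -> nat) :
  exists2 phi : nat -> nat, {homo phi : i j / (i < j)%N}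
    & forall i j, (i <= j)%N -> (v (phi i) <= v (phi j))%N.
Proof.
have minP k : exists j, (k <= j)%N /\ forall l, (k <= l)%N -> (v j <= v l)%N.
  have vk : exists x, `[< exists2 j, (k <= j)%N & v j = x >].
    by exists (v k); apply/asboolP; exists k.
  case: (ex_minnP vk) => x /asboolP[j kj <-] xmin.
  by exists j; split=> // l kl; apply: xmin; apply/asboolP; exists l.
have [f fP] := choice minP.
pose phi k := iter k (fun j => f j.+1) (f 0%N).
have phiS k : (phi k < phi k.+1)%N by case: (fP (phi k).+1).
exists phi.
  apply: (@homo_ltn _ phi (fun i j => (i < j)%N)) => // y x z.
  exact: ltn_trans.
apply: (@homo_leq _ (v \o phi) (fun i j => (i <= j)%N)) => // [y x z|k].
  exact: leq_trans.
have [j j_phi min_phi] : exists2 j, (j <= phi k)%N &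
    forall l, (j <= l)%N -> (v (phi k) <= v l)%N.
  case: k => [|k]; first by exists 0%N; case: (fP 0%N).
  by exists (phi k).+1; case: (fP (phi k).+1).
exact/min_phi/(leq_trans j_phi)/ltnW/phiS.
Qed.

Lemma monomial_good_pair u : exists i j, (i < j)%N /\ (u i <= u j)%MM.
Proof.
have [phi phi_lt phiP] : exists2 phi : nat -> nat, {homo phi : i j / (i < j)%N}
    & forall x i j, x \in enum 'I_n -> (i <= j)%N ->
        (u (phi i) x <= u (phi j) x)%N.
  elim: (enum 'I_n) => [|x s [phi phi_lt phiP]]; first by exists id.
  have [psi psi_lt psiP] := nondecreasing_subsequence (fun i => u (phi i) x).
  exists (phi \o psi) => [i j ij|y i j]; first exact/phi_lt/psi_lt.
  rewrite inE => /predU1P[->|ys] ij; first exact: psiP.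
  by apply: phiP => //; move: ij; rewrite leq_eqVlt => /predU1P[->|/psi_lt/ltnW].
exists (phi 0%N), (phi 1%N); split; first exact: phi_lt.
by apply/mnm_lepP => x; apply: phiP; rewrite ?mem_enum.
Qed.

(** Otherwise one could keep picking elements of [A] divisible by no earlier pick, against
    [monomial_good_pair]. *)
Lemma dickson (A : {pred 'X_{1..n}}) :
  exists2 s : seq 'X_{1..n}, {subset s <= A}
    & forall a, a \in A -> exists2 b, b \in s & (b <= a)%MM.
Proof.
apply: contrapT => nos.
have ext (s : seq 'X_{1..n}) : exists a, {subset s <= A} ->
    a \in A /\ forall b, b \in s -> ~~ (b <= a)%MM.
  apply: contrapT => /forallNP noa; apply: nos; exists s.
    by apply: contrapT => nsA; apply: (noa 0%MM).
  move=> a aA; apply: contrapT => nob; apply: (noa a) => _; split=> // b bs.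
  by apply/negP => ba; apply: nob; exists b.
have [f fP] := choice ext.
pose t k := iter k (fun s => f s :: s) [::].
have tA k : {subset t k <= A}.
  elim: k => //= k IH x; rewrite inE => /predU1P[->|/IH //].
  by case: (fP _ IH).
have ft i j : (i < j)%N -> f (t i) \in t j.
  move=> /subnK <-; elim: (j - _)%N => [|d IH]; first exact: mem_head.
  by rewrite addSn /= inE IH orbT.
have [i [j [ij uij]]] := monomial_good_pair (fun k => f (t k)).
by have [_ /(_ _ (ft i j ij))] := fP _ (tA j); rewrite uij.
Qed.

End Dickson.

(** Division with remainder: by Dickson's lemma finitely many members t of the ideal suffice to
    divide every leading monomial, and subtracting a multiple of one of them lowers the leading
    monomial. *)
Lemma mpoly_noetherian (K : fieldType) n : noetherian {mpoly K[n]}.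
Proof.
move=> W; pose J := ideal_gen W; have JI : is_ideal J := ideal_gen_ideal W.
have [s sL Ls] := dickson
  [pred a | `[< exists f : {mpoly K[n]}, [/\ f \in J, f != 0 & mlead f = a] >]].
have [t tJ tlead] : exists2 t : seq {mpoly K[n]}, {subset t <= J} &
    forall a, a \in s -> exists2 f, f \in t & f != 0 /\ mlead f = a.
  elim: s sL {Ls} => [|a s IH] sL; first by exists [::].
  have [|t tJ tlead] := IH; first by move=> b bs; rewrite sL // inE bs orbT.
  have /asboolP[f [fJ f0 fa]] := sL a (mem_head _ _).
  exists (f :: t) => [g|b]; rewrite inE => /predU1P[->|] //; first exact: tJ.
    by exists f; rewrite ?mem_head.
  by move=> /tlead[g gt gb]; exists g; rewrite // inE gt orbT.
have Jt : {subset J <= ideal_gen (mem t)}.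
  move=> f; move: {2}(mlead f) (erefl (mlead f)) => a fa.
  elim/(well_founded_ind (@ltom_wf n)): a f fa => a IH f fa fJ.
  have [->|f0] := eqVneq f 0; first exact/ideal0/ideal_gen_ideal.
  have [|b bs ba] := Ls a; first by apply/asboolP; exists f.
  have [g gt [g0 gb]] := tlead b bs.
  pose h := (f@_a / g@_b) *: 'X_[a - b] * g.
  have hlead : (mlead h <= a)%O.
    apply: le_trans (mleadM_le _ _) _; rewrite gb.
    have := mleadZ_le (f@_a / g@_b) ('X_[a - b] : {mpoly K[n]}).
    by rewrite mleadXm -(lemc_add2l _ _ b) => /le_trans -> //; rewrite submK.
  have fh : (f - h)@_a = 0.
    have Xg : ('X_[a - b] * g)@_a = g@_b.
      by rewrite -[X in _@_X](submK ba) mulrC mcoeffMX.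
    rewrite mcoeffB /h -scalerAl mcoeffZ Xg divfK ?subrr //.
    by rewrite -gb mleadc_eq0.
  have hJ : h \in J by rewrite idealMl // tJ.
  rewrite -(subrK h f); apply: idealD; first exact: ideal_gen_ideal.
    have [->|fh0] := eqVneq (f - h) 0; first exact/ideal0/ideal_gen_ideal.
    apply: (IH (mlead (f - h))) => //; last exact: idealB.
    rewrite lt_neqAle; apply/andP; split.
      by apply: contra_neq fh0 => fha; apply/eqP; rewrite -mleadc_eq0 fha fh.
    by apply: le_trans (mleadB_le _ _) _; rewrite leUx fa lexx.
  by apply: idealMl; [apply: ideal_gen_ideal|apply: mem_ideal_gen].
(* The basis t lies in the ideal but not in W; it is replaced by the elements of W occurring in
   expressions of its members. *)
suff [r rW tr] : exists2 r : seq {mpoly K[n]}, {subset r <= W}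
    & {subset t <= ideal_gen (mem r)}.
  exists r => // f fW; apply: (ideal_gen_min (ideal_gen_ideal _) tr).
  exact/Jt/mem_ideal_gen.
elim: t tJ {tlead Jt} => [|f t IH] tJ; first by exists [::].
have [|r rW tr] := IH; first by move=> g gt; rewrite tJ // inE gt orbT.
have /asboolP[q /allP qW fE] := tJ f (mem_head _ _).
exists (map snd q ++ r) => [g|g].
  by rewrite mem_cat => /orP[/mapP[p /qW ? ->]|/rW].
rewrite inE => /predU1P[->|/tr].
  rewrite fE; apply: ideal_sum; first exact: ideal_gen_ideal.
  move=> p pq _; apply/idealMl/mem_ideal_gen; first exact: ideal_gen_ideal.
  by have : p.2 \in map snd q ++ r by rewrite mem_cat map_f.
apply: ideal_gen_min; first exact: ideal_gen_ideal.
move=> x xr; apply: mem_ideal_gen.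
by have : x \in map snd q ++ r by rewrite mem_cat [x \in r]xr orbT.
Qed.

(** * Koszul cochains *)

Section Koszul.
Variables (R : comNzRingType) (n : nat).
Implicit Types (A B : {set 'I_n}) (J : {pred R}) (c b e : {set 'I_n} -> R).

Definition position (j : 'I_n) A : nat := #|[set k in A | (k < j)%N]|.

Lemma positionD1 i j A : i \in A ->
  position j A = ((i < j) + position j (A :\ i))%N.
Proof.
move=> iA; rewrite /position (cardsD1 i) inE iA; congr (_ + _)%N.
by apply: eq_card => k; rewrite !inE andbA.
Qed.

Lemma position_swap i j A : i \in A -> j \in A -> i != j ->
  (-1) ^+ position i A * (-1) ^+ position j (A :\ i) =
  - ((-1) ^+ position j A * (-1) ^+ position i (A :\ j)) :> R.
Proof.
move=> iA jA; rewrite (positionD1 i jA) (positionD1 j iA) neq_ltn => ij.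
suff: (-1) ^+ (j < i)%N = - (-1) ^+ (i < j)%N :> R by rewrite !exprD => ->; ring.
by case/orP: ij => ij; rewrite ij ltnNge ltnW //= !expr1 !expr0 ?opprK.
Qed.

Section Differential.
Variable y : 'I_n -> R.

(** The Koszul cochain differential. A cochain is a function on all subsets; its part of degree i is
    the restriction to subsets of size i. *)
Definition kd c A : R :=
  \sum_(j in A) (-1) ^+ position j A * (y j * c (A :\ j)).

Lemma kdZ f c A : kd (fun A => f * c A) A = f * kd c A.
Proof. by rewrite mulr_sumr; apply: eq_bigr => j _; ring. Qed.

Lemma kdB c b A : kd (fun A => c A - b A) A = kd c A - kd b A.
Proof. by rewrite /kd -sumrB; apply: eq_bigr => j _; ring. Qed.

Lemma kd_mod J i c A : is_ideal J -> (forall A, #|A| = i -> c A \in J) ->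
  #|A| = i.+1 -> kd c A \in J.
Proof.
move=> JI cJ Ai; apply: ideal_sum => // j _ jA; do 2 apply: idealMl => //.
by apply: cJ; move: Ai; rewrite (cardsD1 j) jA => -[].
Qed.

Lemma kdK c A : kd (kd c) A = 0.
Proof.
pose F i j := (-1) ^+ position i A * (-1) ^+ position j (A :\ i) *
  (y i * y j * c (A :\ i :\ j)).
have Fswap i j : i \in A -> j \in A -> i != j -> F i j = - F j i.
  move=> iA jA ij; rewrite /F position_swap // !setDDl setUC; ring.
have -> : kd (kd c) A =
    \sum_(p : 'I_n * 'I_n | [&& p.1 \in A, p.2 \in A & p.1 != p.2]) F p.1 p.2.
  rewrite (eq_bigl (fun p : 'I_n * 'I_n => (p.1 \in A) && (p.2 \in A :\ p.1))).
    rewrite -(pair_big_dep (mem A) (fun i j => j \in A :\ i)) /=.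
    apply: eq_bigr => i _; rewrite 2!mulr_sumr; apply: eq_bigr => j _.
    by rewrite /F; ring.
  by move=> [i j] /=; rewrite !inE [j == i]eq_sym [_ && (i != j)]andbC.
have swapK : involutive (fun p : 'I_n * 'I_n => (p.2, p.1)) by case.
rewrite (bigID (fun p : 'I_n * 'I_n => p.1 < p.2)%N) /= addrC.
apply/eqP; rewrite addr_eq0 -sumrN; apply/eqP.
rewrite (reindex_inj (inv_inj swapK)) /=.
apply: eq_big => [[i j]|[i j] /andP[/and3P[/= jA iA ji] _]] /=.
  case: (ltngtP i j) => [||/val_inj ->]; rewrite ?eqxx ?andbF //=.
  by move=> _; rewrite andbCA eq_sym.
by rewrite Fswap // eq_sym.
Qed.

(* Contraction against j is a null-homotopy of the multiplication by y j. *)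
Lemma kd_homotopy J i c j : is_ideal J ->
  (forall A, #|A| = i.+1 -> kd c A \in J) ->
  exists b, forall A, #|A| = i -> y j * c A - kd b A \in J.
Proof.
move=> JI dc.
pose b B := if j \in B then 0 else (-1) ^+ position j (j |: B) * c (j |: B).
have bD1 A k : j \in A -> k != j -> b (A :\ k) = 0.
  by move=> jA kj; rewrite /b !inE eq_sym kj jA.
exists b => A Ai; case: (boolP (j \in A)) => jA.
  rewrite /kd (bigD1 j) //= [X in _ - (_ + X)]big1 => [|k /andP[kA kj]]; last first.
    by rewrite bD1 // !mulr0.
  rewrite /b !inE eqxx /= setD1K // addr0.
  have -> : (-1) ^+ position j A * (y j * ((-1) ^+ position j A * c A)) =
      (-1) ^+ position j A * (-1) ^+ position j A * (y j * c A) :> R by ring.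
  by rewrite -expr2 sqrr_sign mul1r subrr ideal0.
pose A' := j |: A.
have A'j : A' :\ j = A by rewrite setU1K.
have jA' : j \in A' by rewrite !inE eqxx.
suff -> : y j * c A - kd b A = (-1) ^+ position j A' * kd c A'.
  by apply: idealMl => //; apply: dc; rewrite cardsU1 jA Ai.
rewrite /kd [in RHS](bigD1 j) //= A'j mulrDr mulrA -expr2 sqrr_sign mul1r.
congr (_ + _); rewrite -sumrN mulr_sumr.
apply: eq_big => [k|k kA].
  by rewrite !inE; case: (eqVneq k j) => [->|]; rewrite ?(negPf jA) ?andbT.
have kj : j != k by apply: contraNneq jA => ->.
have kA' : k \in A' by rewrite !inE kA orbT.
rewrite /b !inE kj (negPf jA) /=.
have -> : j |: A :\ k = A' :\ k.
  by apply/setP => x; rewrite !inE; case: (eqVneq x j) => [->|]; rewrite ?kj.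
set sj := (-1) ^+ position j A'; set sk := (-1) ^+ position k A.
set sk' := (-1) ^+ position k A'; set sj' := (-1) ^+ position j (A' :\ k).
have swap : sj * sk = - (sk' * sj').
  by have := position_swap jA' kA' kj; rewrite A'j.
have sk1 : sk * sk = 1 by rewrite -expr2 sqrr_sign.
have sk'1 : sk' * sk' = 1 by rewrite -expr2 sqrr_sign.
have -> : sj * (sk' * (y k * c (A' :\ k))) =
    sj * sk * (sk' * sk * (y k * c (A' :\ k))).
  by rewrite -[sj in LHS]mulr1 -sk1; ring.
rewrite swap -[sk in LHS]mul1r -sk'1; ring.
Qed.

(** H^i of the Koszul complex on R/J vanishes, phrased with representatives in R. For [i] = 0 it
    says that no nonzero class of R/J is killed by all [y j]. *)
Definition kvanish J i := forall c,
  (forall A, #|A| = i.+1 -> kd c A \in J) ->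
  exists b, forall A, #|A| = i -> c A - kd b A \in J.

Definition adjoin J f : {pred R} := [pred x | `[< exists u, x - u * f \in J >]].

(** In the sequence H^(i-1)(R/(J+f)) -> H^i(R/J) -> H^i(R/J), the vanishing of the first term makes
    multiplication by f injective. A power of f lies in the ideal of the [y j], which annihilates
    cohomology. For [i] = 0 regularity of f suffices for injectivity. *)
Lemma kvanish_regular J f i : is_ideal J ->
  (exists k, f ^+ k \in ideal_gen [pred h | [exists j, h == y j]]) ->
  (forall g, f * g \in J -> g \in J) ->
  (forall l, i = l.+1 -> kvanish (adjoin J f) l) -> kvanish J i.
Proof.
move=> JI [k fk] freg vanish.
have unscale c : (exists b, forall A, #|A| = i -> f * c A - kd b A \in J) ->
    exists b, forall A, #|A| = i -> c A - kd b A \in J.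
  case=> b cb; case: i vanish cb => [_|l /(_ l erefl) vanish] cb.
    exists (fun=> 0) => A A0; apply: freg; have := cb A A0.
    by rewrite (cards0_eq A0) /kd !big_set0 !subr0.
  have [A Al|e be] := vanish b.
    apply/asboolP; exists (c A); rewrite -opprB idealN // mulrC; exact: cb.
  have /choice[b' b'P] A : exists u, #|A| = l -> b A - kd e A - u * f \in J.
    case: (eqVneq #|A| l) => [/be/asboolP[u ?]|/eqP Al]; first by exists u.
    by exists 0.
  exists b' => A Al; apply: freg.
  have := kd_mod JI b'P Al.
  have -> : kd (fun A => b A - kd e A - b' A * f) A = kd b A - f * kd b' A.
    rewrite kdB kdB kdK subr0 -kdZ; congr (_ - _).
    by apply: eq_bigr => j _; rewrite [b' _ * f]mulrC.
  move=> /(idealD JI (cb A Al)); rewrite mulrBr; congr (_ \in J); ring.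
move=> c dc.
have [b cb] : exists b, forall A, #|A| = i -> f ^+ k * c A - kd b A \in J.
  (* The multipliers that turn c into a coboundary form an ideal, containing each [y j] by
     [kd_homotopy]. *)
  pose killed := [pred h | `[< exists b, forall A, #|A| = i ->
    h * c A - kd b A \in J >]].
  suff: f ^+ k \in killed by move/asboolP.
  apply: (ideal_gen_min _ _ fk); last first.
    by move=> h /existsP[j /eqP ->]; apply/asboolP/kd_homotopy.
  split.
    apply/asboolP; exists (fun=> 0) => A _.
    rewrite mul0r /kd big1 ?subrr ?ideal0 //.
    by move=> j _; rewrite !mulr0.
  move=> a x z /asboolP[b xb] /asboolP[e ze]; apply/asboolP.
  exists (fun A => a * b A - (- e A)) => A Ai; rewrite kdB kdZ.
  have -> : kd (fun A => - e A) A = - kd e A.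
    by rewrite /kd -sumrN; apply: eq_bigr => j _; rewrite !mulrN.
  have := idealD JI (idealMl a JI (xb A Ai)) (ze A Ai).
  congr (_ \in J); ring.
elim: k {fk} b cb => [|k IH] b cb.
  by exists b => A Ai; rewrite -[c A]mul1r -(expr0 f) cb.
have [|b' b'P] := unscale (fun A => f ^+ k * c A); last exact: IH b'P.
by exists b => A Ai; rewrite mulrA -exprS cb.
Qed.

(** Exactness of H^i(R/J) -> H^i(R/(J+f)) -> H^(i+1)(R/J); the cochain e below represents the image
    of c under the connecting map. *)
Lemma kvanish_adjoin J f i : is_ideal J ->
  (forall g, f * g \in J -> g \in J) -> kvanish J i -> kvanish J i.+1 ->
  kvanish (adjoin J f) i.
Proof.
move=> JI freg vani vanS c dc.
have /choice[e eP] A : exists u, #|A| = i.+1 -> kd c A - u * f \in J.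
  case: (eqVneq #|A| i.+1) => [/dc/asboolP[u ?]|/eqP Al]; first by exists u.
  by exists 0.
have [A Ai|b eb] := vanS e.
  apply: freg; have := kd_mod JI eP Ai.
  have -> : kd (fun A => kd c A - e A * f) A = - (f * kd e A).
    rewrite kdB kdK sub0r -kdZ; congr (- _).
    by apply: eq_bigr => j _; rewrite [e _ * f]mulrC.
  by move/(idealN JI); rewrite opprK.
have [A Ai|b' b'P] := vani (fun A => c A - f * b A).
  rewrite kdB kdZ; have := idealD JI (eP A Ai) (idealMl f JI (eb A Ai)).
  congr (_ \in J); ring.
exists b' => A Ai; apply/asboolP; exists (b A).
have := b'P A Ai; congr (_ \in J); ring.
Qed.

(** No set has n + 1 elements, so the constant 1 is a cocycle in degree n, while coboundaries take
    values in the ideal of the [y j]. *)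
Lemma kvanish_card_false J : is_ideal J -> kvanish J n ->
  1 \in ideal_gen [predU J & [pred h | [exists j, h == y j]]].
Proof.
move=> JI /(_ (fun=> 1))[A An|b /(_ setT)].
  by have := max_card (mem A); rewrite card_ord An ltnn.
rewrite cardsT card_ord => /(_ erefl) cb.
set G := ideal_gen _; have GI : is_ideal G by apply: ideal_gen_ideal.
rewrite -(subrK (kd b setT) 1); apply: idealD => //.
  by apply: mem_ideal_gen; rewrite inE /= cb.
apply: ideal_sum => // j _ _; apply: idealMl => //; rewrite mulrC.
apply: idealMl => //; apply: mem_ideal_gen; rewrite inE /=; apply/orP; right.
by apply/existsP; exists j.
Qed.

End Differential.
End Koszul.

(** * Depth and Koszul cohomology *)

Section Depth.
Variables (R : comNzRingType) (n : nat) (y : 'I_n -> R) (m : {pred R}).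
Hypotheses (noethR : noetherian R) (mI : is_ideal m) (m1 : 1 \notin m).
Hypotheses (ym : forall j, y j \in m)
  (m_rad : forall f, f \in m ->
     exists k, f ^+ k \in ideal_gen [pred h | [exists j, h == y j]]).
Implicit Types (J : {pred R}) (fs : seq R).

Lemma adjoin_ideal J f : is_ideal J -> is_ideal (adjoin J f).
Proof.
move=> JI; split; first by apply/asboolP; exists 0; rewrite mul0r subrr ideal0.
move=> a x z /asboolP[u xu] /asboolP[v zv]; apply/asboolP; exists (a * u + v).
have := idealD JI (idealMl a JI xu) zv; congr (_ \in J); ring.
Qed.

Definition extension J fs : {pred R} := ideal_gen [predU J & fs].

Lemma extension_nil J : is_ideal J -> extension J [::] = J.
Proof.
move=> JI; apply/funext => x; apply/idP/idP; last first.
  by move=> xJ; apply: mem_ideal_gen; rewrite inE /= [x \in J]xJ.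
have sub : {subset extension J [::] <= J}.
  by apply: ideal_gen_min => // z; rewrite !inE orbF.
exact: sub.
Qed.

Lemma extension_rcons J fs f :
  extension J (rcons fs f) = adjoin (extension J fs) f.
Proof.
have EI gs : is_ideal (extension J gs) by apply: ideal_gen_ideal.
have AI := adjoin_ideal f (EI fs).
have sub : {subset extension J (rcons fs f) <= adjoin (extension J fs) f}.
  apply: ideal_gen_min => // z; rewrite inE /= mem_rcons inE => zJ.
  apply/asboolP; case: (eqVneq z f) zJ => [->|_] /= zJ.
    by exists 1; rewrite mul1r subrr ideal0.
  by exists 0; rewrite mul0r subr0; apply: mem_ideal_gen.
apply/funext => x; apply/idP/idP; first exact: sub.
case/asboolP => u xu; change (x \in extension J (rcons fs f)).
rewrite -(subrK (u * f) x); apply: idealD => //.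
  apply: ideal_gen_min xu => // z; rewrite inE /= => zJ; apply: mem_ideal_gen.
  by rewrite inE /= mem_rcons inE orbCA zJ orbT.
apply: idealMl => //; apply: mem_ideal_gen.
by rewrite inE /= mem_rcons inE eqxx orbT.
Qed.

Lemma regular_seq_rcons J fs f : {subset J <= m} ->
  {subset rcons fs f <= m} -> regular_seq J (rcons fs f) <->
    regular_seq J fs /\ forall g, f * g \in extension J fs -> g \in extension J fs.
Proof.
move=> Jm fsm.
have no1 : 1 \notin extension J (rcons fs f).
  apply/negP => /(ideal_gen_min mI _) H; case/negP: m1; apply: H => x.
  by rewrite inE => /orP[/Jm|/fsm].
have no1' : 1 \notin extension J fs.
  apply: contra no1; rewrite extension_rcons => E; apply/asboolP; exists 0.
  by rewrite mul0r subr0.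
have take_l k : (k <= size fs)%N -> take k (rcons fs f) = take k fs.
  by move=> ks; rewrite -cats1 takel_cat.
rewrite /regular_seq size_rcons; split=> [[reg _]|[[reg _] freg]].
  split=> [|g]; last first.
    have := reg (size fs) (leqnn _) g.
    by rewrite nth_rcons ltnn eqxx take_l // take_size.
  split=> [k ks g|]; last by rewrite take_size.
  by have := reg k (ltnW ks) g; rewrite nth_rcons ks take_l // ltnW.
split=> [k|]; last by rewrite take_oversize // size_rcons.
rewrite ltnS leq_eqVlt => /predU1P[->|ks] g.
  by rewrite nth_rcons ltnn eqxx take_l // take_size; apply: freg.
by rewrite nth_rcons ks take_l ?(ltnW ks) //; apply: reg.
Qed.

(** Removing the last element of [fs] raises [d] by one; [d] is there for this induction and ends up
    being 0. *)
Lemma regular_seq_kvanish J fs : is_ideal J -> {subset J <= m} ->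
  {subset fs <= m} -> regular_seq J fs ->
  forall d i, (forall l, (l < d)%N -> kvanish y (extension J fs) l) ->
  (i < size fs + d)%N -> kvanish y J i.
Proof.
move=> JI Jm; elim/last_ind: fs => [|fs f IH] fsm reg d i van.
  by rewrite extension_nil // in van; apply: van.
have fm : f \in m by rewrite fsm // mem_rcons mem_head.
have [{}reg freg] := (regular_seq_rcons Jm fsm).1 reg.
rewrite size_rcons addSnnS; apply: IH => // [x xs|l ld].
  by rewrite fsm // mem_rcons inE xs orbT.
apply: (kvanish_regular (f := f)) => //.
- exact: ideal_gen_ideal.
- exact: m_rad.
by move=> l' El; rewrite -extension_rcons; apply: van; rewrite -ltnS -El.
Qed.

(** Vanishing of H^0 means that m kills no nonzero class, so m contains a regular element; adjoining
    it shortens the range of vanishing by one. *)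
Lemma kvanish_regular_seq J k : is_ideal J -> {subset J <= m} ->
  (forall i, (i < k)%N -> kvanish y J i) ->
  exists fs, [/\ {subset fs <= m}, regular_seq J fs & size fs = k].
Proof.
move=> JI Jm van.
suff ext l : (l <= k)%N -> exists fs, [/\ {subset fs <= m}, regular_seq J fs,
    size fs = l & forall i, (i < k - l)%N -> kvanish y (extension J fs) i].
  by have [fs [fsm reg fsk _]] := ext k (leqnn k); exists fs.
elim: l => [_|l IH lk].
  exists [::]; split=> //; last first.
    by move=> i; rewrite extension_nil // subn0; apply: van.
  split=> //=; apply: contra m1 => H; apply: ideal_gen_min H => // z.
  by rewrite !inE orbF => /Jm.
have [fs [fsm reg fsl vanl]] := IH (ltnW lk).
have EI : is_ideal (extension J fs) by apply: ideal_gen_ideal.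
have [f fm freg] : exists2 f, f \in m & forall g,
    f * g \in extension J fs -> g \in extension J fs.
  apply: exists_regular => // g mg.
  have [||b] := vanl 0%N _ (fun=> g); first by rewrite subn_gt0.
    by move=> A A1; apply: ideal_sum => // j _ _; apply: idealMl => //; apply: mg.
  by move=> /(_ set0); rewrite cards0 /kd big_set0 subr0; apply.
have fsfm : {subset rcons fs f <= m}.
  by move=> x; rewrite mem_rcons inE => /predU1P[->|/fsm].
exists (rcons fs f); split=> //; first exact/regular_seq_rcons.
  by rewrite size_rcons fsl.
move=> i il; rewrite extension_rcons; apply: kvanish_adjoin => //; apply: vanl.
  by apply: leq_trans il _; rewrite leq_sub2l.
by move: il; rewrite subnS; case: (k - l)%N.
Qed.

(** The range of vanishing is bounded by n, so a largest one exists; hence [is_depth] is satisfiable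
    and [xget] does not return its default. *)
Lemma leq_depth_at J k : is_ideal J -> {subset J <= m} ->
  (k <= depth_at m J)%N <-> forall i, (i < k)%N -> kvanish y J i.
Proof.
move=> JI Jm.
have bound l : (forall i, (i < l)%N -> kvanish y J i) -> (l <= n)%N.
  move=> van; rewrite leqNgt; apply/negP => nl; case/negP: m1.
  apply: ideal_gen_min (kvanish_card_false JI (van n nl)) => // x.
  by rewrite inE /= => /orP[/Jm|/existsP[j /eqP ->]].
pose P l := `[< forall i, (i < l)%N -> kvanish y J i >].
have exP : exists l, P l by exists 0%N; apply/asboolP.
have ubP l : P l -> (l <= n)%N by move/asboolP/bound.
case: (ex_maxnP exP ubP) => d /asboolP vand maxd.
have vanfs fs : {subset fs <= m} -> regular_seq J fs ->
    forall i, (i < size fs)%N -> kvanish y J i.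
  move=> fsm reg i ifs.
  by apply: (regular_seq_kvanish JI Jm fsm reg (d := 0)) => //; rewrite addn0.
have dd : is_depth m J d.
  split; first exact: kvanish_regular_seq.
  by move=> fs fsm reg; apply/maxd/asboolP/vanfs.
have : is_depth m J (depth_at m J) by apply: classical_sets.xgetPex; exists d.
case=> [[fs [fsm reg fsd]] max_fs]; split=> [kd i ik|van].
  by apply: (vanfs fs) => //; rewrite fsd; apply: leq_trans kd.
have [gs [gsm greg <-]] := kvanish_regular_seq JI Jm van.
exact: max_fs.
Qed.

End Depth.

(** * Monomial ideals and graded pieces *)

Lemma radical_ideal (R : comNzRingType) (J : {pred R}) :
  is_ideal J -> is_ideal (radical J).
Proof.
move=> JI; split; first by apply/asboolP; exists 1%N; rewrite expr1 ideal0.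
move=> a x y /asboolP[p xp] /asboolP[q yq]; apply/asboolP; exists (p + q)%N.
rewrite exprDn; apply: ideal_sum => // i _ _.
rewrite -mulr_natl; apply: idealMl => //; case: (leqP q i) => qi.
  by rewrite -(subnK qi) exprD mulrA; apply: idealMl.
rewrite -addnBA; last exact: ltnW.
by rewrite exprD exprMn -!mulrA mulrCA mulrC; apply: idealMl.
Qed.

Section MonomialIdeals.
Variables (K : fieldType) (n : nat).
Local Notation S := {mpoly K[n]}.
Implicit Types (J : {pred S}) (a b : 'X_{1..n}) (F : {set 'I_n}).

Definition monomial_support J := forall f : S,
  f \in J <-> forall a, a \in msupp f -> 'X_[a] \in J.

Definition monomials (A : {pred 'X_{1..n}}) : {pred S} :=
  [pred f | `[< exists2 a, a \in A & f = 'X_[a] >]].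

Lemma idealX_le J a b : is_ideal J -> (a <= b)%MM -> 'X_[a] \in J ->
  'X_[b] \in J.
Proof. by move=> JI /submK <- aJ; rewrite mpolyXD idealMl. Qed.

Lemma mem_ideal_monomials A (f : S) : f \in ideal_gen (monomials A) <->
  forall b, b \in msupp f -> exists2 a, a \in A & (a <= b)%MM.
Proof.
split.
  pose Z : {pred S} := [pred f : S | `[< forall b, b \in msupp f ->
    exists2 a, a \in A & (a <= b)%MM >]].
  suff sub : {subset ideal_gen (monomials A) <= Z} by move/sub/asboolP.
  apply: ideal_gen_min => [|_ /asboolP[a aA ->]]; last first.
    by apply/asboolP => b; rewrite msuppX inE => /eqP ->; exists a;
      rewrite ?lepm_refl.
  split; first by apply/asboolP => b; rewrite msupp0.
  move=> g x z /asboolP xZ /asboolP zZ; apply/asboolP => b /msuppD_le.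
  rewrite mem_cat => /orP[/msuppM_le/allpairsP[[b1 b2] /=]|/zZ //].
  case=> _ /xZ[a aA ab] ->.
  by exists a => //; apply: lepm_trans ab (lem_addl _ _).
move=> fA; rewrite [f]mpolyE; apply: ideal_sum => [|b bf _].
  exact: ideal_gen_ideal.
have [a aA ab] := fA b bf; rewrite -mul_mpolyC.
apply: idealMl; first exact: ideal_gen_ideal.
apply: idealX_le ab _; first exact: ideal_gen_ideal.
by apply/mem_ideal_gen/asboolP; exists a.
Qed.

Lemma monomial_ideal_support J : monomial_ideal J -> monomial_support J.
Proof.
case=> A JA f; rewrite !JA; split=> [/mem_ideal_monomials fA a /fA aA|fA].
  rewrite JA; apply/mem_ideal_monomials => b.
  by rewrite msuppX inE => /eqP ->.
apply/mem_ideal_monomials => a /fA; rewrite JA => /mem_ideal_monomials; apply.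
by rewrite msuppX mem_head.
Qed.

Lemma mem_face_prime F (f : S) : f \in face_prime K F <->
  forall a, a \in msupp f -> exists2 i, i \notin F & (0 < a i)%N.
Proof.
have -> : face_prime K F = ideal_gen (monomials
    [pred a | [exists i, (i \notin F) && (a == U_(i)%MM)]]).
  congr ideal_gen; apply/funext => g; apply/existsP/asboolP.
    move=> [i /andP[iF /eqP ->]]; exists U_(i)%MM => //.
    by apply/existsP; exists i; rewrite iF eqxx.
  by move=> [a /existsP[i /andP[iF /eqP ->]] ->]; exists i; rewrite iF eqxx.
have lemU i a : (U_(i) <= a)%MM = (0 < a i)%N.
  apply/mnm_lepP/idP => [/(_ i)|ai j]; rewrite mnm1E ?eqxx //.
  by case: eqP => [<-|].
split=> [/mem_ideal_monomials|] fF; [|apply/mem_ideal_monomials] => a /fF.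
  by move=> [b /existsP[i /andP[iF /eqP ->]]]; rewrite lemU; exists i.
move=> [i iF ai]; exists U_(i)%MM; rewrite ?lemU //.
by apply/existsP; exists i; rewrite iF eqxx.
Qed.

Lemma face_prime_ideal F : is_ideal (face_prime K F).
Proof. exact: ideal_gen_ideal. Qed.

Lemma face_primeX F a :
  ('X_[a] \in face_prime K F) = [exists i, (i \notin F) && (0 < a i)%N].
Proof.
apply/idP/existsP => [/mem_face_prime/(_ a)|[i /andP[iF ai]]].
  by rewrite msuppX mem_head => -[//|i iF ai]; exists i; rewrite iF.
by apply/mem_face_prime => b; rewrite msuppX inE => /eqP ->; exists i.
Qed.

Lemma face_prime_sub0 F : {subset face_prime K F <= face_prime K set0}.
Proof.
move=> f /mem_face_prime fF; apply/mem_face_prime => a /fF[i _ ai].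
by exists i; rewrite ?inE.
Qed.

Lemma max_ideal_proper : (1 : S) \notin face_prime K set0.
Proof.
rewrite -mpolyX0 face_primeX; apply/existsP => -[i].
by rewrite mnm0E ltnn andbF.
Qed.

Lemma leq_depth (J : {pred S}) N k : (0 < N)%N -> is_ideal J ->
  {subset J <= face_prime K set0} ->
  (k <= depth J)%N <->
    forall i, (i < k)%N -> kvanish (fun j => 'X_[U_(j) *+ N] : S) J i.
Proof.
move=> N0; apply: leq_depth_at.
- exact: mpoly_noetherian.
- exact: face_prime_ideal.
- exact: max_ideal_proper.
- move=> j; rewrite face_primeX; apply/existsP; exists j.
  by rewrite inE mulmnE mnm1E eqxx mul1n.
set J' := ideal_gen _ => f f0; suff: f \in radical J' by move/asboolP.
have JI : is_ideal J' by apply: ideal_gen_ideal.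
apply: ideal_gen_min f0 => [|g /existsP[j /andP[_ /eqP ->]]].
  exact: radical_ideal.
apply/asboolP; exists N; rewrite mpolyXn.
by apply/mem_ideal_gen/existsP; exists j.
Qed.

End MonomialIdeals.

Section GradedPieces.
Variables (K : fieldType) (n : nat).
Local Notation S := {mpoly K[n]}.
Implicit Types (A B : {set 'I_n}) (X : {set {set 'I_n}}).
Implicit Types (phi psi : {set 'I_n} -> K).

(* Degrees count points: [acyclic X i] is about reduced cohomology in         *)
(* simplicial degree i - 1.                                                   *)
Definition coboundary X phi A : K :=
  \sum_(j in A | A :\ j \in X) (-1) ^+ position j A * phi (A :\ j).

Definition acyclic X i := forall phi,
  (forall A, A \in X -> #|A| = i.+1 -> coboundary X phi A = 0) ->
  exists psi, forall A, A \in X -> #|A| = i -> phi A = coboundary X psi A.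

Lemma mcoeffXM a b (f : S) :
  ('X_[a] * f)@_b = if (a <= b)%MM then f@_(b - a) else 0.
Proof.
rewrite mulrC; case: ifPn => [ab|nab].
  by rewrite -[in LHS](submK ab) addmC mcoeffMX.
apply/eqP; rewrite mcoeff_eq0 (perm_mem (msuppMX _ _)).
by apply: contra nab => /mapP[c _ ->]; rewrite lem_addr.
Qed.

Lemma mcoeff_signM k (f : S) b : ((-1) ^+ k * f)@_b = (-1) ^+ k * f@_b.
Proof.
rewrite -signr_odd -[in RHS]signr_odd.
by case: (odd k); rewrite ?expr1 ?expr0 ?mulN1r ?mul1r ?mcoeffN.
Qed.

Variables (N : nat) (J : {pred S}).
Hypotheses (JI : is_ideal J) (Jmon : monomial_support J).
Implicit Types (g : 'X_{1..n}).

Let y (j : 'I_n) : S := 'X_[U_(j) *+ N].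

(* The basis cochain at A is placed in degree N (1 - 1_A), so that the        *)
(* differential is homogeneous.                                               *)
Definition shift A : 'X_{1..n} :=
  [multinom (if i \in A then 0 else N) | i < n]%N.

(** These sets index a K-basis of the degree g part of the Koszul complex of S/J. *)
Definition graded_piece g :=
  [set A | (shift A <= g)%MM && ('X_[g - shift A] \notin J)].

Lemma shiftD1 j A : j \in A -> shift (A :\ j) = (U_(j) *+ N + shift A)%MM.
Proof.
move=> jA; apply/mnmP => i; rewrite mnmDE mulmnE mnm1E !mnmE !inE eq_sym.
by case: eqP => [<-|_]; rewrite ?jA ?mul1n ?addn0.
Qed.

Lemma mcoeff_kd g A (c : {set 'I_n} -> S) : A \in graded_piece g ->
  (kd y c A)@_(g - shift A) =
  coboundary (graded_piece g) (fun B => (c B)@_(g - shift B)) A.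
Proof.
rewrite inE => /andP[Ag AJ].
rewrite /kd /coboundary big_mkcondr raddf_sum /=; apply: eq_bigr => j jA.
rewrite mcoeff_signM mcoeffXM inE shiftD1 //.
have le_sub : (U_(j) *+ N <= g - shift A)%MM = (U_(j) *+ N + shift A <= g)%MM.
  apply/mnm_lepP/mnm_lepP => H i; move/mnm_lepP: Ag => /(_ i); move: (H i);
  by rewrite mnmDE mnmBE; lia.
rewrite le_sub; case: ifPn => le; last by rewrite mulr0.
(* The monomial at [A :\ j] divides the one at [A], which is not in J. *)
rewrite ifT; last first.
  apply: contra AJ; apply: idealX_le => //; apply/mnm_lepP => i.
  by rewrite !mnmBE mnmDE; lia.
congr (_ * mcoeff _ _); apply/mnmP => i; rewrite !mnmBE mnmDE; lia.
Qed.

Lemma kd_graded g (phi : {set 'I_n} -> K) A :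
  kd y (fun B => if B \in graded_piece g then phi B *: 'X_[g - shift B] else 0) A
  = coboundary (graded_piece g) phi A *: 'X_[g - shift A].
Proof.
rewrite /kd /coboundary big_mkcondr scaler_suml; apply: eq_bigr => j jA.
case: ifPn => AjP; last by rewrite !mulr0 scale0r.
have gE : (U_(j) *+ N + (g - shift (A :\ j)) = g - shift A)%MM.
  apply/mnmP => i; move: AjP; rewrite inE => /andP[/mnm_lepP/(_ i)].
  by rewrite shiftD1 // !mnmDE !mnmBE mnmDE; lia.
rewrite -scalerAr -mpolyXD gE -signr_odd -[in RHS]signr_odd -scalerA.
by rewrite mulr_sign scaler_sign.
Qed.

(** Taking coefficients splits a cochain into homogeneous parts; conversely, primitives found in
    each degree are summed over the finitely many degrees of c. *)
Lemma kvanish_graded_piece i : kvanish y J i <->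
  forall g, acyclic (graded_piece g) i.
Proof.
split=> [van g phi dphi|acy c dc].
  have [A Ai|b bc] := van
      (fun B => if B \in graded_piece g then phi B *: 'X_[g - shift B] else 0).
    rewrite kd_graded; case: (boolP (A \in graded_piece g)) => [AP|].
      by rewrite dphi // scale0r ideal0.
    rewrite inE negb_and => AP.
    case: (pickP [pred j in A | A :\ j \in graded_piece g]) => [j|none].
      move=> /andP[jA]; rewrite !inE => /andP[le _].
      have leA : (shift A <= g)%MM.
        by apply: lepm_trans le; rewrite shiftD1 // lem_addl.
      by move: AP; rewrite leA /= negbK -mul_mpolyC => /idealMl; apply.
    by rewrite /coboundary big_pred0 ?scale0r ?ideal0.
  exists (fun B => (b B)@_(g - shift B)) => A AP Ai.
  rewrite -mcoeff_kd //; apply/eqP; rewrite -subr_eq0.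
  have AJ : 'X_[g - shift A] \notin J by move: AP; rewrite inE => /andP[].
  move: (bc A Ai); rewrite AP => /Jmon/(_ (g - shift A)%MM).
  rewrite mcoeff_msupp mcoeffB mcoeffZ mcoeffX eqxx mulr1 => H.
  by apply/contraT => /H; rewrite (negPf AJ).
have /choice[psi psiP] g : exists psi : {set 'I_n} -> K, forall A,
    A \in graded_piece g -> #|A| = i ->
    (c A)@_(g - shift A) = coboundary (graded_piece g) psi A.
  apply: (acy g (fun A => (c A)@_(g - shift A))) => A AP Ai.
  rewrite -mcoeff_kd //; move: (dc A Ai) => /Jmon/(_ (g - shift A)%MM) H.
  move: AP; rewrite inE => /andP[_ AJ].
  by apply/eqP/contraT; rewrite -mcoeff_msupp => /H; rewrite (negPf AJ).
(* All degrees occurring in c; in any other degree the relevant coefficients of c and of b are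
   zero. *)
pose degs := undup (flatten [seq [seq (a + shift A)%MM | a <- msupp (c A)]
  | A <- enum {set 'I_n}]).
pose b B : S := \sum_(g <- degs | B \in graded_piece g) psi g B *: 'X_[g - shift B].
have bE g B : B \in graded_piece g ->
    (b B)@_(g - shift B) = if g \in degs then psi g B else 0.
  move=> BP; have gB h : B \in graded_piece h -> h != g ->
      (psi h B *: 'X_[h - shift B])@_(g - shift B) = 0.
    move: BP; rewrite !inE => /andP[/submK gE _] /andP[/submK hE _] hg.
    rewrite mcoeffZ mcoeffX; case: eqP => [hgE|]; last by rewrite mulr0.
    by case/eqP: hg; rewrite -gE -hE hgE.
  rewrite raddf_sum /=; case: ifPn => gdegs; last first.
    rewrite big1_seq // => h /andP[Bh hdegs]; apply: gB => //.
    by apply: contraNneq gdegs => <-.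
  rewrite big_mkcond (bigD1_seq g) ?undup_uniq //= BP big1 => [|h hg]; last first.
    by case: ifP => // Bh; apply: gB.
  by rewrite addr0 mcoeffZ mcoeffX eqxx mulr1.
exists b => A Ai; apply/Jmon => a; apply: contraTT => aJ.
pose g := (a + shift A)%MM; have ga : (g - shift A)%MM = a by rewrite /g addmK.
have AP : A \in graded_piece g by rewrite inE ga aJ lem_addl.
rewrite -mcoeff_eq0 mcoeffB -ga mcoeff_kd // subr_eq0 psiP //.
case: (boolP (g \in degs)) => gdegs.
  by apply/eqP/eq_bigr => j /andP[_ AjP]; rewrite bE // gdegs.
rewrite -psiP // [X in _ == X]big1 => [|j /andP[_ AjP]]; last first.
  by rewrite bE // (negPf gdegs) mulr0.
rewrite ga mcoeff_eq0; apply: contra gdegs => aA; rewrite mem_undup.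
by apply/flatten_mapP; exists A; rewrite ?mem_enum //; apply/mapP; exists a.
Qed.

End GradedPieces.

(** * Degree complexes *)

Section BoundedExponents.
Variables (K : fieldType) (n : nat).
Local Notation S := {mpoly K[n]}.
Implicit Types (J : {pred S}) (a b : 'X_{1..n}) (A B F G : {set 'I_n}).
Implicit Types (Gamma : {set {set 'I_n}}).

Definition truncate N a : 'X_{1..n} := [multinom minn (a i) N | i < n]%N.

Definition indicator N B : 'X_{1..n} :=
  [multinom (if i \in B then N else 0) | i < n]%N.

Definition bounded_exponents N J :=
  forall a, 'X_[a] \in J -> 'X_[truncate N a] \in J.

(* The faces of the complex whose Stanley-Reisner ideal is the radical of     *)
(* J : 'X_[a].                                                                *)
Definition colon_complex N J a : {set {set 'I_n}} :=
  [set B | 'X_[a + indicator N B] \notin J].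

(** Up to signs and a shift by the size of G, this carries the cochains of Gamma restricted to the
    complement of G. *)
Definition upper_part G Gamma : {set {set 'I_n}} :=
  [set A : {set 'I_n} | (G \subset A) && (A :\: G \in Gamma)].

Lemma truncate_mem N J a b : is_ideal J -> bounded_exponents N J ->
  truncate N a = truncate N b -> ('X_[a] \in J) = ('X_[b] \in J).
Proof.
move=> JI Jb ab.
have trE c : ('X_[c] \in J) = ('X_[truncate N c] \in J).
  apply/idP/idP => [/Jb //|]; apply: idealX_le => //; apply/mnm_lepP => i.
  by rewrite mnmE geq_minl.
by rewrite trE ab -trE.
Qed.

(** A coordinate below [N.+1] cannot absorb the shift, so its index is forced into A. At other
    indices of A the exponent exceeds N, which J cannot tell from an added N. The power [N.+1] is
    positive even for [N] = 0. *)
Lemma graded_piece_upper N J g : is_ideal J -> bounded_exponents N J ->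
  graded_piece N.+1 J g = upper_part [set i | g i < N.+1]%N
    (colon_complex N J
      [multinom (if g i < N.+1 then g i else g i - N.+1) | i < n]%N).
Proof.
move=> JI Jb; apply/setP => A; rewrite !inE.
have -> : (shift N.+1 A <= g)%MM = ([set i | g i < N.+1]%N \subset A).
  apply/mnm_lepP/subsetP => [le i|sub i].
    by rewrite inE => gi; move: (le i); rewrite mnmE; case: ifP => //; lia.
  rewrite mnmE; case: ifPn => // iA; rewrite leqNgt; apply: contra iA => gi.
  by apply: sub; rewrite inE.
case: (boolP (_ \subset A)) => //= sub; congr negb; apply: (truncate_mem JI Jb).
apply/mnmP => i; rewrite !(mnmBE, mnmDE, mnmE) !inE.
case: (boolP (i \in A)) => iA; case: ltnP => gi; rewrite ?iA /=; try lia.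
by case/negP: iA; apply: (subsetP sub); rewrite inE.
Qed.

(** Truncating a at N keeps its coordinates on G below [N.+1]; the others receive [N.+1] so as to
    stay outside. *)
Lemma upper_graded_piece N J a G : is_ideal J -> bounded_exponents N J ->
  exists g, graded_piece N.+1 J g = upper_part G (colon_complex N J a).
Proof.
move=> JI Jb.
exists [multinom
  (if i \in G then minn (a i) N else minn (a i) N + N.+1) | i < n]%N.
rewrite graded_piece_upper //; congr upper_part.
  by apply/setP => i; rewrite inE mnmE; case: ifP => _; lia.
apply/setP => B; rewrite !inE; congr negb; apply: (truncate_mem JI Jb).
apply/mnmP => i; rewrite !(mnmDE, mnmE).
by case: (i \in G); case: (i \in B); case: ifP; lia.
Qed.

Lemma leq_depth_colon_complex N J k : is_ideal J -> monomial_support J ->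
  {subset J <= face_prime K set0} -> bounded_exponents N J ->
  (k <= depth J)%N <-> forall a G i, (i < k)%N ->
    acyclic K (upper_part G (colon_complex N J a)) i.
Proof.
move=> JI Jmon Jm Jb; rewrite (leq_depth k (ltn0Sn N) JI Jm).
split=> [van a G i /van|acy i ik].
  have [g <-] := upper_graded_piece a G JI Jb.
  by move/(kvanish_graded_piece _ JI Jmon _).1; apply.
apply/(kvanish_graded_piece _ JI Jmon _) => g.
by rewrite graded_piece_upper //; apply: acy.
Qed.

End BoundedExponents.

(** * Stanley-Reisner ideals and their colon complexes *)

Section StanleyReisner.
Variables (K : fieldType) (n : nat) (Gamma : {set {set 'I_n}}).
Hypothesis Gcomplex : simplicial_complex Gamma.
Local Notation J := (SR_ideal K Gamma).
Implicit Types (a b : 'X_{1..n}) (A B F : {set 'I_n}).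

Definition mnm_support a : {set 'I_n} := [set i | 0 < a i]%N.

Lemma face_in_facet A : A \in Gamma ->
  exists2 F, F \in facets Gamma & A \subset F.
Proof.
move=> AG; have [F Fmax AF] := maxset_exists (P := fun A => A \in Gamma) AG.
by exists F; rewrite // inE.
Qed.

Lemma facet_face F : F \in facets Gamma -> F \in Gamma.
Proof. by rewrite inE => /maxsetp. Qed.

Lemma mem_SR_ideal (f : {mpoly K[n]}) : f \in J <->
  forall F, F \in facets Gamma -> f \in face_prime K F.
Proof. by split=> [/forall_inP|fJ]; last exact/forall_inP. Qed.

Lemma SR_ideal_ideal : is_ideal J.
Proof.
split; first by apply/mem_SR_ideal => F _; apply: ideal0 (face_prime_ideal K F).
move=> a x y /mem_SR_ideal xJ /mem_SR_ideal yJ; apply/mem_SR_ideal => F FG.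
have FI := face_prime_ideal K F.
by apply: idealD; [|apply: idealMl => //; apply: xJ|apply: yJ].
Qed.

Lemma SR_ideal_support : monomial_support J.
Proof.
move=> f; split=> [/mem_SR_ideal fJ a af|fJ]; apply/mem_SR_ideal => F FG.
  have /mem_face_prime/(_ a af)[i iF ai] := fJ F FG.
  by rewrite face_primeX; apply/existsP; exists i; rewrite iF.
apply/mem_face_prime => a /fJ /mem_SR_ideal/(_ F FG).
by rewrite face_primeX => /existsP[i /andP[iF ai]]; exists i.
Qed.

Lemma SR_idealX a : ('X_[a] \in J) = (mnm_support a \notin Gamma).
Proof.
apply/idP/idP => [/mem_SR_ideal aJ|aG].
  apply/negP => /face_in_facet[F /aJ]; rewrite face_primeX => /existsP[i].
  by move=> /andP[iF ai] /subsetP/(_ i); rewrite inE (negPf iF) ai => /(_ isT).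
apply/mem_SR_ideal => F /facet_face FG; rewrite face_primeX.
apply: contraNT aG => /existsPn noi.
apply: (proj2 Gcomplex F) => //; apply/subsetP => i; rewrite inE => ai.
by move: (noi i); rewrite ai andbT negbK.
Qed.

Lemma SR_ideal_proper : {subset J <= face_prime K set0}.
Proof.
move=> f /mem_SR_ideal fJ; have /set0Pn[A /face_in_facet[F FG _]] := proj1 Gcomplex.
exact: face_prime_sub0 (fJ F FG).
Qed.

Lemma SR_ideal_bounded : bounded_exponents 1 J.
Proof.
move=> a; rewrite !SR_idealX.
suff -> : mnm_support (truncate 1 a) = mnm_support a by [].
by apply/setP => i; rewrite !inE mnmE leq_min andbT.
Qed.

(** This is the star of the support of a, void when the support is not a face. *)
Lemma colon_complex_SR a :
  colon_complex 1 J a = [set B | mnm_support a :|: B \in Gamma].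
Proof.
apply/setP => B; rewrite in_set SR_idealX negbK in_set.
suff -> : mnm_support (a + indicator 1 B) = mnm_support a :|: B by [].
by apply/setP => i; rewrite !inE mnmDE mnmE; case: (i \in B); lia.
Qed.

End StanleyReisner.

Lemma leq_depth_SR (K : fieldType) n (J : {pred {mpoly K[n]}}) N k :
  is_ideal J -> monomial_support J -> {subset J <= face_prime K set0} ->
  bounded_exponents N J ->
  (forall a, colon_complex N J a != set0 ->
    simplicial_complex (colon_complex N J a)) ->
  (k <= depth J)%N <-> forall a, colon_complex N J a != set0 ->
    (k <= depth (SR_ideal K (colon_complex N J a)))%N.
Proof.
move=> JI Jmon Jm Jb Jcomplex; rewrite (leq_depth_colon_complex k JI Jmon Jm Jb).
have depth_SR a : colon_complex N J a != set0 -> _ :=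
  fun a0 => leq_depth_colon_complex k (SR_ideal_ideal K _) (@SR_ideal_support K n _)
    (SR_ideal_proper (Jcomplex a a0)) (@SR_ideal_bounded K _ _ (Jcomplex a a0)).
split=> [acy a a0|acy a G i ik].
  rewrite depth_SR // => b G i ik.
  rewrite colon_complex_SR; last exact: Jcomplex.
  have -> : [set B | mnm_support b :|: B \in colon_complex N J a] =
      colon_complex N J (a + indicator N (mnm_support b)).
    apply/setP => B; rewrite !inE; congr negb; apply: (truncate_mem JI Jb).
    apply/mnmP => j; rewrite !(mnmDE, mnmE) !inE.
    by case: (0 < b j)%N; case: (j \in B) => /=; lia.
  exact: acy.
(* For a void complex the depth hypothesis says nothing, but the upper part is empty and any cochain
   is a primitive. *)
have [a0|a0] := eqVneq (colon_complex N J a) set0.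
  by move=> phi _; exists phi => A; rewrite a0 !inE andbF.
have := (depth_SR a a0).1 (acy a a0) 0%MM G i ik.
rewrite colon_complex_SR; last exact: Jcomplex.
suff -> : [set B | mnm_support 0 :|: B \in colon_complex N J a] =
    colon_complex N J a.
  exact.
suff s0 : mnm_support (0%MM : 'X_{1..n}) = set0.
  by apply/setP => B; rewrite in_set s0 set0U.
by apply/setP => j; rewrite !inE mnm0E.
Qed.

(** * Primary components and degree complexes *)

Section PrimaryComponents.
Variables (K : fieldType) (n : nat) (D : {set {set 'I_n}}).
Variables (I : {pred {mpoly K[n]}}) (IF : {set 'I_n} -> {pred {mpoly K[n]}}).
Hypothesis Dcomplex : simplicial_complex D.
Hypothesis IF_primary :
  forall F, F \in facets D -> primary_to (face_prime K F) (IF F).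
Hypothesis IF_cap : forall f, (f \in I) = [forall F in facets D, f \in IF F].
Implicit Types (a b : 'X_{1..n}) (F B : {set 'I_n}).

Lemma primary_component_ideal F : F \in facets D -> is_ideal (IF F).
Proof. by case/IF_primary => /idealr_closed_ideal. Qed.

Lemma primary_component_sub F : F \in facets D ->
  {subset IF F <= face_prime K F}.
Proof.
by case/IF_primary => _ _ rad f fF; rewrite -rad; apply/asboolP; exists 1%N.
Qed.

(** Monomials in the variables of F lie outside P_F, so they are nonzerodivisors modulo a
    P_F-primary ideal. *)
Lemma primary_component_cancel F a b : F \in facets D ->
  mnm_support b \subset F ->
  'X_[a + b] \in IF F -> 'X_[a] \in IF F.
Proof.
case/IF_primary => _ prim rad bF; rewrite mpolyXD => /prim[//|].
rewrite rad face_primeX => /existsP[i /andP[iF bi]].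
by move/subsetP: bF => /(_ i); rewrite inE (negPf iF) bi => /(_ isT).
Qed.

Lemma primary_component_power : exists N, forall F i, F \in facets D ->
  i \notin F -> 'X_[U_(i) *+ N] \in IF F.
Proof.
have /choice[e eP] (p : {set 'I_n} * 'I_n) : exists k, p.1 \in facets D ->
    p.2 \notin p.1 -> 'X_[U_(p.2) *+ k] \in IF p.1.
  case: p => F i /=; case: (boolP (F \in facets D)) => FD; last by exists 0%N.
  case: (boolP (i \in F)) => iF; first by exists 0%N.
  have [_ _ rad] := IF_primary FD.
  have /asboolP[k kF] : ('X_i : {mpoly K[n]}) \in radical (IF F).
    rewrite rad face_primeX; apply/existsP; exists i.
    by rewrite iF mnm1E eqxx.
  by exists k; rewrite -mpolyXn.
exists (\max_p e p) => F i FD iF.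
have /= := eP (F, i) FD iF; apply: idealX_le; first exact: primary_component_ideal.
apply/mnm_lepP => j; rewrite !mulmnE leq_mul2l (leq_bigmax (F, i)).
exact: orbT.
Qed.

Variable N : nat.
Hypothesis IF_power : forall F i, F \in facets D ->
  i \notin F -> 'X_[U_(i) *+ N] \in IF F.

Lemma primary_component_large F a i : F \in facets D -> i \notin F ->
  (N <= a i)%N -> 'X_[a] \in IF F.
Proof.
move=> FD iF ai; apply: idealX_le (IF_power FD iF).
  exact: primary_component_ideal.
apply/mnm_lepP => j; rewrite mulmnE mnm1E.
by case: eqP => [<-|_]; rewrite ?mul1n ?mul0n.
Qed.

(** For each F, either truncation leaves an exponent N at a variable outside F, or it only changes
    exponents on F, which can be cancelled. *)
Lemma intersection_bounded : bounded_exponents N I.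
Proof.
move=> a; rewrite !IF_cap => /forall_inP aI; apply/forall_inP => F FD.
case: (pickP [pred i | (i \notin F) && (N <= a i)%N]) => [i /andP[iF ai]|small].
  by apply: (primary_component_large FD iF); rewrite mnmE leq_min ai leqnn.
apply: (primary_component_cancel (b := (a - truncate N a)%MM)) => //.
  apply/subsetP => i; rewrite inE mnmBE mnmE => ai; apply/negPn/negP => iF.
  by move: (small i); rewrite /= iF /=; lia.
rewrite addmC submK ?aI //; apply/mnm_lepP => i.
by rewrite mnmE geq_minl.
Qed.

(** Multiplying by N-th powers of the variables in B leads into I_F once B leaves F, and can be
    cancelled while B stays inside F. *)
Lemma colon_complex_degree_complex a :
  colon_complex N I a = degree_complex IF D a.
Proof.
apply/setP => B; rewrite [LHS]in_set [RHS]in_set IF_cap negb_forall_in.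
apply/exists_inP/exists_inP => -[F FD].
  move=> BF; exists F => //; apply/andP; split.
    by apply: contra BF; apply: idealX_le (lem_addr _ _);
      apply: primary_component_ideal.
  apply/subsetP => i iB; apply: contraR BF => iF.
  by apply: (primary_component_large FD iF); rewrite mnmDE mnmE iB leq_addl.
case/andP=> aF BF; exists F => //; apply: contra aF.
apply: primary_component_cancel => //; apply/subsetP => i.
by rewrite inE mnmE; case: ifPn => // iB _; apply: (subsetP BF).
Qed.

Lemma degree_complex_simplicial a : degree_complex IF D a != set0 ->
  simplicial_complex (degree_complex IF D a).
Proof.
split=> // A B; rewrite !in_set => /exists_inP[F FD /andP[aF AF]] BA.
by apply/exists_inP; exists F; rewrite // aF (subset_trans BA).
Qed.

Lemma facets_nonempty : exists F, F \in facets D.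
Proof.
by have /set0Pn[A /face_in_facet[F]] := proj1 Dcomplex; exists F.
Qed.

Lemma leq_depth_degree_complex k : is_ideal I -> monomial_ideal I ->
  (k <= depth I)%N <-> forall a, degree_complex IF D a != set0 ->
    (k <= depth (SR_ideal K (degree_complex IF D a)))%N.
Proof.
move=> II Imon.
have Im : {subset I <= face_prime K set0}.
  move=> f; rewrite IF_cap => /forall_inP fI.
  have [F FD] := facets_nonempty.
  exact/face_prime_sub0/(primary_component_sub FD)/fI.
rewrite (@leq_depth_SR K n I N) //.
- by split=> dep a; have := dep a; rewrite colon_complex_degree_complex.
- exact: monomial_ideal_support.
- exact: intersection_bounded.
by move=> a; rewrite colon_complex_degree_complex; apply: degree_complex_simplicial.
Qed.

Lemma degree_complex0 : degree_complex IF D 0%MM = D.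
Proof.
apply/setP => A; rewrite in_set; apply/exists_inP/idP => [[F FD /andP[_ AF]]|AD].
  exact: (proj2 Dcomplex F) (facet_face FD) AF.
have [F FD AF] := face_in_facet AD; exists F; rewrite // AF andbT.
apply/negP => /(primary_component_sub FD); rewrite face_primeX => /existsP[i].
by rewrite mnm0E andbF.
Qed.

Lemma L_set_degree_complex G a : simplicial_complex G ->
  facets G \subset facets D -> a \in L_set IF D G -> degree_complex IF D a = G.
Proof.
move=> Gcomplex GD /andP[/forall_inP aout /forall_inP ain].
apply/setP => A; rewrite in_set; apply/exists_inP/idP => [[F FD /andP[aF AF]]|AG].
  suff FG : F \in facets G by apply: (proj2 Gcomplex F) (facet_face FG) AF.
  by apply: contraNT aF => FG; apply: aout; rewrite inE FG.
have [F FG AF] := face_in_facet AG.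
by exists F; rewrite ?(subsetP GD) // ain.
Qed.

Lemma mem_L_set_degree_complex a : a \in L_set IF D (degree_complex IF D a).
Proof.
rewrite inE; apply/andP; rewrite facets_degree_complex.
split; apply/forall_inP => F; rewrite !in_set; last by case/andP.
by case/andP=> + FD; rewrite FD /= negbK.
Qed.

End PrimaryComponents.

Theorem theorem1 (K : fieldType) (n : nat) (D : {set {set 'I_n}}) (t : nat)
    (I : {pred {mpoly K[n]}}) (IF : {set 'I_n} -> {pred {mpoly K[n]}})
    (HD : simplicial_complex D) (Dpure : pure D)
    (Ddepth : depth (SR_ideal K D) = t)
    (I_ideal : idealr_closed I) (I_monomial : monomial_ideal I)
    (I_unmixed : unmixed I) (I_rad : radical I =i SR_ideal K D)
    (IF_primary : forall F, F \in facets D -> primary_to (face_prime K F) (IF F))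
    (IF_cap : forall f, (f \in I) = [forall F in facets D, f \in IF F]) :
  [<-> depth I = depth (radical I);
       forall a : 'X_{1..n}, degree_complex IF D a != set0 ->
         (t <= depth (SR_ideal K (degree_complex IF D a)))%N;
       forall G : {set {set 'I_n}}, simplicial_complex G ->
         facets G \subset facets D -> (depth (SR_ideal K G) < t)%N ->
         L_set IF D G =i pred0].
Proof.
have -> : radical I = SR_ideal K D by apply/funext => f; apply: I_rad.
have [N IF_power] := primary_component_power IF_primary.
have depthI k := leq_depth_degree_complex HD IF_primary IF_cap IF_power k
  (idealr_closed_ideal I_ideal) I_monomial.
rewrite Ddepth; tfae=> [depthIt|dep G Gcomplex GD Gt a|noL].
- by apply/depthI; rewrite depthIt.
- apply/negP => aL.
  have Ga := L_set_degree_complex Gcomplex GD aL.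
  by have := dep a; rewrite Ga leqNgt Gt => /(_ (proj1 Gcomplex)).
apply/eqP; rewrite eqn_leq; apply/andP; split.
  (* The exponent a = 0 gives the upper bound t for depth S/I. *)
  have D0 := degree_complex0 HD IF_primary.
  rewrite -Ddepth -{1}D0; apply: (depthI _).1 => //.
  by rewrite D0; case: HD.
(* A degree complex of depth below t would be a Gamma as in (c), with a itself in its L-set. *)
apply/depthI => a a0; rewrite leqNgt; apply/negP => Gt.
have GD : facets (degree_complex IF D a) \subset facets D.
  by rewrite facets_degree_complex; apply/subsetP => F; rewrite in_set => /andP[].
have := noL _ (degree_complex_simplicial a0) GD Gt a.
by rewrite mem_L_set_degree_complex.
Qed.
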